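(* Let $m$ be a positive integer, let $K$ be an integer with $0\le K\le m-1$, and let $a_1,a_2$ be non-negative integers. Then $$\begin{aligned}S_m(\{a_1,a_2\},K)={}&\left(\left\lfloor\frac{a_1+a_2}{m}\right\rfloor-\left\lfloor\frac{a_1}{m}\right\rfloor-\left\lfloor\frac{a_2}{m}\right\rfloor\right)(K+1)\\&+\max\bigl(0,\,((a_1+a_2)\bmod m)+K-m+1\bigr)\\&-\max\bigl(0,\,(a_1\bmod m)+K-m+1\bigr)\\&-\max\bigl(0,\,(a_2\bmod m)+K-m+1\bigr).\end{aligned}$$
   Context: For a positive integer $m$ and non-negative integers $a_1,a_2,K$ (with $a_1=a_2$ allowed; $\{a_1,a_2\}$ is just a list of parameters), define $$S_m(\{a_1,a_2\},K)=\sum_{k=0}^K\left(\left\lfloor\frac{a_1+a_2+k}{m}\right\rfloor-\left\lfloor\frac{a_1+k}{m}\right\rfloor-\left\lfloor\frac{a_2+k}{m}\right\rfloor+\left\lfloor\frac{k}{m}\right\rfloor\right).$$ For an integer $a$, $(a \bmod m)$ denotes the minimal non-negative representative of the class of $a$ in $\mathbb{Z}/m$, i.e. the integer in $\{0,\dots,m-1\}$ congruent to $a$ modulo $m$. *)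

(* Defs.v *)
From mathcomp Require Import all_boot all_order all_algebra.

Set Implicit Arguments.
Unset Strict Implicit.
Unset Printing Implicit Defensive.

Import Order.TTheory GRing.Theory Num.Theory.
Local Open Scope ring_scope.

(* [floor_sum m a1 a2 K] is S_m({a1, a2}, K). Each floor is a quotient of natural
   numbers, hence [%/] on nat; the quotients are cast to [int] before being
   subtracted, because subtraction on nat is truncated. *)
Definition floor_sum (m a1 a2 K : nat) : int :=
  \sum_(0 <= k < K.+1)
    (((a1 + a2 + k) %/ m)%N%:Z - ((a1 + k) %/ m)%N%:Z
     - ((a2 + k) %/ m)%N%:Z + (k %/ m)%N%:Z).

(* Main.v *)
(* Each of the four sums of floors is computed separately. For [0 <= k < m] the
   floor of [(a + k) / m] exceeds that of [a / m] by 1 exactly when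
   [m <= a %% m + k], and by 0 otherwise; there are
   [max(0, a %% m + K - m + 1)] such [k] in [0..K]. *)
Require Import Defs.
From mathcomp Require Import all_boot all_order all_algebra.
From mathcomp Require Import zify ring.

Set Implicit Arguments.
Unset Strict Implicit.
Unset Printing Implicit Defensive.

Import Order.TTheory GRing.Theory Num.Theory.
Local Open Scope ring_scope.

(** Induction on [n]: passing to [n + 1] raises the maximum by one exactly when
    [m <= a %% m + n]. *)
Lemma sum_divn_shift (m n a : nat) : (0 < m)%N -> (n <= m)%N ->
  \sum_(0 <= k < n) ((a + k) %/ m)%N%:Z =
    (a %/ m)%N%:Z * n%:Z + Num.max 0 ((a %% m)%N%:Z + n%:Z - m%:Z).
Proof.
move=> m_gt0; have lt_am := ltn_pmod a m_gt0.
(* For the empty sum the maximum is 0 because [a %% m < m]. *)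
elim: n => [|n IHn] lt_nm; first by rewrite big_geq // mulr0 add0r; lia.
(* Since [n < m], [divnD] leaves [a %/ m] plus the carry bit of [a %% m + n]. *)
rewrite big_nat_recr //= IHn ?(ltnW lt_nm) // divnD // (divn_small lt_nm).
rewrite (modn_small lt_nm) addn0 PoszD -[n.+1]addn1 PoszD mulrDr mulr1.
by case: leqP => /=; lia.
Qed.

Theorem proposition5 (m K a1 a2 : nat) (m_gt0 : (0 < m)%N)
    (K_le : (K <= m - 1)%N) :
  floor_sum m a1 a2 K =
    (((a1 + a2) %/ m)%N%:Z - (a1 %/ m)%N%:Z - (a2 %/ m)%N%:Z) * (K%:Z + 1)
    + Num.max 0 (((a1 + a2) %% m)%N%:Z + K%:Z - m%:Z + 1)
    - Num.max 0 ((a1 %% m)%N%:Z + K%:Z - m%:Z + 1)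
    - Num.max 0 ((a2 %% m)%N%:Z + K%:Z - m%:Z + 1).
Proof.
have lt_Km : (K < m)%N by lia.
have sum0 : \sum_(0 <= k < K.+1) (k %/ m)%N%:Z = 0 :> int.
  by apply: big1_seq => k /=; rewrite mem_index_iota => lt_kK; rewrite divn_small; lia.
rewrite /floor_sum big_split /= sum0 !sumrB !sum_divn_shift //.
(* The range [0..K] has [K + 1] terms, whence the [+ 1] inside each maximum. *)
have shift (r : nat) : r%:Z + K.+1%:Z - m%:Z = r%:Z + K%:Z - m%:Z + 1 by lia.
by rewrite !shift -[K.+1]addn1 PoszD; ring.
Qed.
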